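(* For every $(t,x)\in\mathbf{N}\times\partial B$ and every $f\in\mathcal{M}_B^d$, $$\mathbf{E}[f(Z_t^x)]=\mathbf{E}[\mathcal{N}f(Z_t^x)],$$ where $\mathcal{N}:\mathcal{M}_B^d\to\mathcal{M}_{B^c\setminus\partial B}^d$ is the discrete Carr-Nadtochiy transform defined in the context.
   Context: Let $\mathbf{N}=\{1,2,\dots\}$, $d\in\mathbf{N}$, $e_1,\dots,e_d$ the standard unit vectors of $\mathbf{Z}^d$, $B=\{x\in\mathbf{Z}^d: x_d>0\}$, $\partial B=\{x\in\mathbf{Z}^d: x_d=0\}$, so $B^c\setminus\partial B=\{x\in\mathbf{Z}^d: x_d<0\}$. For $x\in\mathbf{Z}^d$, $(Z_t^x)_{t\in\mathbf{Z}_+}$ denotes a discrete-time, time-homogeneous Markov chain on $\mathbf{Z}^d$ started at $x$ (all with the same transition kernel), with $\sum_{i=1}^d P(Z_1^x=x+e_i)+\sum_{i=1}^d P(Z_1^x=x-e_i)=1$ and $P(Z_1^x=x+e_i)>0$, $P(Z_1^x=x-e_i)>0$ for all $i=1,\dots,d$ and all $x\in\mathbf{Z}^d$. For $A\subset\mathbf{Z}^d$, $\mathcal{M}_A^d$ is the set of functions $\mathbf{Z}^d\to\mathbf{R}$ vanishing outside $A$. For $(t,x)\in\mathbf{N}\times\partial B$, with $\|\cdot\|$ the $\ell^1$-norm, let $$\mathcal{S}(t,x)=\{(s,y)\in\mathbf{N}\times\partial B:\ 1\le s\le t,\ \|y-x\|\le t-s,\ t-s-\|y-x\|\text{ is even}\},$$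 a finite set containing $(t,x)$. Let $W^{+}_{t,x}$ and $W^{-}_{t,x}$ be the square matrices indexed by $\mathcal{S}(t,x)\times\mathcal{S}(t,x)$ with entry in row $(s,y)$, column $(u,z)$ equal to $P(Z_s^y=z+u e_d)$ and $P(Z_s^y=z-u e_d)$, respectively. These matrices are invertible. Put $\mathcal{N}_{t,x}=(W^-_{t,x})^{-1}W^+_{t,x}$. For $h\in\mathcal{M}_B^d$, apply $\mathcal{N}_{t,x}$ to the vector $(h(z+ue_d))_{(u,z)\in\mathcal{S}(t,x)}$ and denote the $(s,y)$-component of the result by $\mathcal{N}_{t,x}h(y-se_d)$, for $(s,y)\in\mathcal{S}(t,x)$. The map $\mathcal{N}:\mathcal{M}_B^d\to\mathcal{M}_{B^c\setminus\partial B}^d$ is defined by $\mathcal{N}h(x-te_d)=\mathcal{N}_{t,x}h(x-te_d)$ for $(t,x)\in\mathbf{N}\times\partial B$ (and $\mathcal{N}h=0$ on $B\cup\partial B$). *)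

(* Defs.v *)
From mathcomp Require Import all_boot all_order all_algebra finmap.
From mathcomp Require Import all_classical all_reals all_analysis.

Set Implicit Arguments.
Unset Strict Implicit.
Unset Printing Implicit Defensive.

Import Order.TTheory GRing.Theory Num.Theory.

Local Open Scope classical_set_scope.
Local Open Scope ring_scope.

(* The lattice of dimension d.+1 >= 1; the last coordinate is ord_max. *)
Notation Zd d := 'rV[int]_d.+1.

Section Lattice.
Variable d : nat.
Implicit Types (x y : Zd d).

Definition unitv (i : 'I_d.+1) : Zd d := delta_mx 0 i.

Definition e_last : Zd d := unitv ord_max.

Definition upper : set (Zd d) := [set x | 0 < x 0 ord_max].

Definition bdry : set (Zd d) := [set x | x 0 ord_max = 0].

Definition lower : set (Zd d) := [set x | x 0 ord_max < 0].

Definition l1norm x : nat := (\sum_i `|x 0%R i|)%N.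

(* The subtractions are truncated, but the first condition gives s <= t, and
   the second one makes the outer subtraction in the third exact. *)
Definition S_set (t : nat) x : set (nat * Zd d) :=
  [set p | [/\ (1 <= p.1 <= t)%N /\ bdry p.2,
               (l1norm (p.2 - x) <= t - p.1)%N
             & ~~ odd (t - p.1 - l1norm (p.2 - x)) ]].

Lemma finite_S_set t x : finite_set (S_set t x).
Proof.
apply: (@sub_finite_set _ _ ((fun q : 'I_t.+1 * {ffun 'I_d.+1 -> 'I_t.+1 * bool} =>
   (val q.1, x + \row_i (if (q.2 i).2 then (val (q.2 i).1)%:Z
                         else - (val (q.2 i).1)%:Z))) @` setT)); last first.
  by apply: finite_image; exact: finite_finset.
move=> [s y] /= [[/andP[s1 st] _] yx _].
pose v := y - x.
have vb i : (`|v 0%R i| < t.+1)%N.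
  rewrite ltnS (leq_trans _ (leq_subr s t))// (leq_trans _ yx)//.
  by rewrite /l1norm (bigD1 i)//= leq_addr.
exists (Ordinal (st : (s < t.+1)%N), [ffun i => (Ordinal (vb i), 0 <= v 0 i)]) => //=.
congr pair; apply/rowP => i; rewrite !mxE ffunE /=.
have -> : (if 0 <= v 0 i then `|v 0%R i|%N%:Z else - `|v 0%R i|%N%:Z) = v 0 i.
  by case: ifPn => [|]; rewrite -?ltNge abszE => ?;
    [rewrite ger0_norm | rewrite ltr0_norm// opprK].
by rewrite /v !mxE addrC subrK.
Qed.

Lemma S_set_self t x : (0 < t)%N -> bdry x -> S_set t x (t, x).
Proof.
move=> t0 xb; have l0 : l1norm (x - x) = 0%N.
  by rewrite subrr /l1norm big1// => i _; rewrite mxE.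
by split; rewrite /= ?l0 ?subnn// t0 leqnn.
Qed.

(* By finite_S_set, membership in S_fset t x is membership in S_set t x. *)
Definition S_fset t x : {fset nat * Zd d} := fset_set (S_set t x).

Definition vanishes_outside (R : realType) (A : set (Zd d)) (h : Zd d -> R) :=
  forall x, ~ A x -> h x = 0.

End Lattice.

Section MarkovChain.
Context {disp : measure_display} {T : measurableType disp} {R : realType}.
Variables (P : probability T R) (d : nat).

Definition prob (A : set T) : R := fine (P A).

Definition past (X : nat -> T -> Zd d) (n : nat) (z : nat -> Zd d) : set T :=
  [set w | forall i, (i <= n)%N -> X i w = z i].

(* X is a time-homogeneous Markov chain started at x with transition kernel p;
   Zd d carries the discrete sigma-algebra.  Stochasticity of p is not required
   separately: it follows when a chain with kernel p is started at each point,
   since then p x is the law of the chain started at x at time 1. *)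
Definition markov_chain (p : Zd d -> Zd d -> R) (x : Zd d)
    (X : nat -> T -> Zd d) : Prop :=
  [/\ forall n (A : set (Zd d)), measurable (X n @^-1` A),
      prob [set w | X 0%N w = x] = 1
    & forall n (z : nat -> Zd d), prob (past X n z) != 0 ->
        prob (past X n z `&` [set w | X n.+1 w = z n.+1]) / prob (past X n z)
        = p (z n) (z n.+1)].

End MarkovChain.

Section CarrNadtochiy.
Context {disp : measure_display} {T : measurableType disp} {R : realType}.
Variables (P : probability T R) (d : nat).
(* Z x n is the position at time n of the chain started at x. *)
Variable Z : Zd d -> nat -> T -> Zd d.

Definition law (y : Zd d) (s : nat) (v : Zd d) : R :=
  prob P [set w | Z y s w = v].

(* Matrices indexed by S_fset t x through the enumeration of this finite type *)
Definition Wplus (t : nat) (x : Zd d) : 'M[R]_#|{: S_fset t x}| :=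
  \matrix_(i, j) let: (s, y) := val (enum_val i) in
                 let: (u, z) := val (enum_val j) in
                 law y s (z + e_last d *+ u).

Definition Wminus (t : nat) (x : Zd d) : 'M[R]_#|{: S_fset t x}| :=
  \matrix_(i, j) let: (s, y) := val (enum_val i) in
                 let: (u, z) := val (enum_val j) in
                 law y s (z - e_last d *+ u).

(* For the chains considered, Wminus t x is triangular for the order given by
   the time component, with positive diagonal: invmx is a genuine inverse. *)
Definition CN_mx t x : 'M[R]_#|{: S_fset t x}| :=
  invmx (Wminus t x) *m Wplus t x.

Definition upper_vec t x (h : Zd d -> R) : 'cV[R]_#|{: S_fset t x}| :=
  \col_j let: (u, z) := val (enum_val j) in h (z + e_last d *+ u).

(* The component at q of CN_mx t x applied to h, i.e. the value
   denoted N_{t,x} h (q.2 - q.1 e_d); 0 if q is not in S_fset t x. *)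
Definition CN_comp t x (h : Zd d -> R) (q : nat * Zd d) : R :=
  if insub q is Some k
  then (CN_mx t x *m upper_vec t x h) (enum_rank (k : S_fset t x)) 0
  else 0.

(* A point v with negative last coordinate is x - t e_d for t = |v_d| and
   x = v + t e_d. *)
Definition CN (h : Zd d -> R) (v : Zd d) : R :=
  if v 0 ord_max < 0 then
    let t := `|v 0%R ord_max|%N in
    let x := v + e_last d *+ t in
    CN_comp t x h (t, x)
  else 0.

Lemma CN_vanishes_outside h : vanishes_outside (@lower d) (CN h).
Proof.
by move=> v v_lower; rewrite /CN; case: ifPn => // v_lt0; case: v_lower.
Qed.

Lemma CN_sub h (t : nat) (x : Zd d) : (0 < t)%N -> bdry x ->
  CN h (x - e_last d *+ t) = CN_comp t x h (t, x).
Proof.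
move=> t0 xb; rewrite /CN.
have -> : (x - e_last d *+ t) 0 ord_max = - t%:Z.
  have x0 : x 0 ord_max = 0 by [].
  by rewrite mxE x0 add0r mxE mulmxnE mxE !eqxx -[X in _ = - X]natz.
by rewrite Num.Theory.oppr_lt0 ltz_nat t0 abszN absz_nat subrK.
Qed.

End CarrNadtochiy.

(* Main.v *)
Require Import Defs.
From mathcomp Require Import all_boot all_order all_algebra finmap.
From mathcomp Require Import all_classical all_reals all_analysis.
From mathcomp Require Import measurable_realfun zify.

(** A nearest-neighbour walk started at a point of the hyperplane [bdry] that
ends at time [s] at distance [u] above or below a point [z] of [bdry] satisfies
[u <= s], and [z] lies within distance [s - u] of the start, with the right
parity. So at time [t] a walk from [x] can only end in the open upper half-space
at a point [z + u e], and in the open lower half-space at a point [z - u e], with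
[(u, z)] in [S(t, x)]. For [f] vanishing outside the upper half-space, this gives
<<
  E[f(Z_t^x)]  =  (W^+ f)(t, x)  =  (W^- (N_{t,x} f))(t, x),
>>
the second equality because [N_{t,x} = (W^-)^-1 W^+]. The right-hand side is
[E[N f(Z_t^x)]] as soon as [N_{t,x} f] and [N f] agree on all of [S(t, x)], that
is, [N_{t,x} f (z - u e) = N_{u,z} f (z - u e)] for [(u, z)] in [S(t, x)].

Two facts remain.

- Invertibility ([Wminus_unit]). The entry of [W^-] in row [(s, y)] and column
  [(u, z)] vanishes unless [u < s] or [(u, z) = (s, y)], and the diagonal entry is
  the probability that the walk goes straight down, which is positive. A vector
  killed by [W^-] therefore vanishes, by strong induction on the time component
  ([Wminus_kernel]).

- Consistency ([CN_comp_restrict]). The triangle inequality makes [S(u, z)] a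
  subset of [S(t, x)] for [(u, z)] in [S(t, x)], and the rows of [W^+] and [W^-]
  indexed by [S(u, z)] vanish in the columns outside [S(u, z)]
  ([vertical_sum_restrict]). So the restriction of [N_{t,x} f] to [S(u, z)] solves
  the linear system that defines [N_{u,z} f], whose solution is unique.

The Markov property enters only through two consequences: the walk almost surely
stays in the set [reach] allowed by distance and parity ([chain_reach_ae]), and
the straight descent has positive probability ([law_down_gt0]). Both follow from
the product formula for the probabilities of finite paths ([prob_pastS]). *)

Set Implicit Arguments.
Unset Strict Implicit.
Unset Printing Implicit Defensive.

Import Order.TTheory GRing.Theory Num.Theory.
Local Open Scope classical_set_scope.
Local Open Scope ring_scope.

(** * Lattice geometry *)

Section Lattice.
Context {d : nat}.
Implicit Types (x y z v : Zd d) (k : Zd d) (m n s t u : nat).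

Lemma l1norm0 : l1norm (0 : Zd d) = 0%N.
Proof. by rewrite /l1norm big1// => i _; rewrite mxE. Qed.

Lemma l1norm_eq0 v : l1norm v = 0%N -> v = 0.
Proof.
move=> v0; apply/rowP => i; rewrite mxE; apply/eqP; rewrite -absz_eq0 -leqn0.
by apply: leq_trans (eq_leq v0); rewrite /l1norm (bigD1 i)//= leq_addr.
Qed.

Lemma l1normD x y : (l1norm (x + y) <= l1norm x + l1norm y)%N.
Proof.
rewrite /l1norm -big_split/=; apply: leq_sum => i _; rewrite mxE.
by move: (x 0 i) (y 0 i) => a b; lia.
Qed.

Lemma odd_l1normD x y :
  odd (l1norm (x + y)) = odd (l1norm x) (+) odd (l1norm y).
Proof.
have oddE v : odd (l1norm v) = \big[addb/false]_i odd `|v 0%R i|%N.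
  by rewrite /l1norm (big_morph odd oddD (erefl _)).
rewrite !oddE -big_split/=; apply: eq_bigr => i _; rewrite mxE.
by move: (x 0 i) (y 0 i) => a b; lia.
Qed.

(** Upward and downward displacements are treated together throughout: [k] stands
for [e_last d] or for its opposite. *)
Lemma l1norm_vertical k z u : (k = e_last d \/ k = - e_last d) -> bdry z ->
  l1norm (z + k *+ u) = (l1norm z + u)%N.
Proof.
move=> kE z0; rewrite /l1norm (bigD1 ord_max)//= [in RHS](bigD1 ord_max)//=.
rewrite [z 0 ord_max]z0 addnAC; congr addn; last first.
  apply: eq_bigr => i /negPf iN; rewrite mxE mulmxnE.
  by case: kE => ->; rewrite !mxE iN ?oppr0 mul0rn addr0.
rewrite mxE [z 0 ord_max]z0 add0r mulmxnE.
by case: kE => ->; rewrite !mxE !eqxx/=; lia.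
Qed.

(** The points that a nearest-neighbour walk from [x] can occupy at time [n]. Each
step changes the parity of the distance to [x] and lengthens it by at most one. *)
Definition reach x n y : bool :=
  (l1norm (y - x) <= n)%N && ~~ odd (n - l1norm (y - x)).

Lemma reach0 x y : reach x 0 y -> y = x.
Proof.
case/andP=> + _; rewrite leqn0 => /eqP/l1norm_eq0/eqP.
by rewrite subr_eq0 => /eqP.
Qed.

Lemma reach_refl x : reach x 0 x.
Proof. by rewrite /reach subrr l1norm0. Qed.

Lemma reach_trans x y z m n : reach x m y -> reach y n z -> reach x (m + n) z.
Proof.
move=> /andP[xy oxy] /andP[yz oyz]; rewrite /reach.
have -> : z - x = (z - y) + (y - x) by rewrite addrA subrK.
have := l1normD (z - y) (y - x); have := odd_l1normD (z - y) (y - x).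
lia.
Qed.

Lemma reach_vertical k y z s u : (k = e_last d \/ k = - e_last d) ->
  bdry y -> bdry z ->
  reach y s (z + k *+ u) = (u <= s)%N && reach y (s - u) z.
Proof.
move=> kE y0 z0.
have zy0 : bdry (z - y) by rewrite /bdry/= !mxE [z 0 _]z0 [y 0 _]y0 subrr.
rewrite /reach addrAC l1norm_vertical// addnC subnDA andbA; congr andb.
by move: (l1norm _) => l; lia.
Qed.

Lemma reach_unitv x v i : v = x + unitv i \/ v = x - unitv i -> reach x 1 v.
Proof.
have l1 : l1norm (unitv i) = 1%N :> nat.
  rewrite /l1norm (bigD1 i)//= big1 => [|j /negPf ji];
  by rewrite mxE !eqxx ?ji.
have l1N : l1norm (- unitv i) = 1%N :> nat.
  by apply: etrans l1; apply: eq_bigr => j _; rewrite mxE abszN.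
by rewrite /reach => -[] ->; rewrite addrAC subrr add0r ?l1 ?l1N.
Qed.

Lemma S_fsetP t x s y : reflect
  [/\ (1 <= s <= t)%N, bdry y & reach x (t - s) y] ((s, y) \in S_fset t x).
Proof.
rewrite /S_fset in_fset_set; last exact: finite_S_set.
apply: (iffP idP) => [|[st y0 /andP[? ?]]].
  by rewrite inE => -[[? ?] /= ? ?]; split => //; apply/andP.
by rewrite inE; split.
Qed.

Lemma S_fset_self t x : (0 < t)%N -> bdry x -> (t, x) \in S_fset t x.
Proof. by move=> t0 x0; apply/S_fsetP; rewrite t0 leqnn subnn reach_refl. Qed.

(** Membership of [(s, y)] means that a walk of length [t] from [x] can be at [y]
with [s] steps left; any walk from [y] can then be appended to it. *)
Lemma S_fset_sub t x s y : (s, y) \in S_fset t x ->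
  (S_fset s y `<=` S_fset t x)%fset.
Proof.
move=> /S_fsetP[st y0 xy]; apply/fsubsetP => -[u z] /S_fsetP[us z0 yz].
apply/S_fsetP; split => //; first by lia.
have -> : (t - u = (t - s) + (s - u))%N by lia.
exact: reach_trans xy yz.
Qed.

(** [S_fset s y] indexes the points off the hyperplane that a walk from [y] can
occupy at time [s], on either side of it. *)
Lemma reach_vertical_S k s y u z : (k = e_last d \/ k = - e_last d) ->
  (0 < u)%N -> bdry y -> bdry z ->
  reach y s (z + k *+ u) = ((u, z) \in S_fset s y).
Proof.
move=> kE u0 y0 z0; rewrite reach_vertical//.
by apply/andP/S_fsetP => [[us ?]|[]]; rewrite ?u0 ?us//.
Qed.

End Lattice.

(** * Column vectors indexed by a finite set *)

Section FsetVectors.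
Context {R : realType} {I : choiceType} {S : {fset I}}.

Definition fset_vec (g : I -> R) : 'cV[R]_#|{: S}| :=
  \col_j g (val (enum_val j)).

(** The default value outside [S] is the one chosen in [CN_comp], so that
[CN_comp P Z t x h] is convertible to [vec_fun (CN_mx P Z t x *m upper_vec t x h)]. *)
Definition vec_fun (c : 'cV[R]_#|{: S}|) (q : I) : R :=
  if insub q is Some k then c (enum_rank (k : S)) 0 else 0.

Lemma vec_funK : cancel vec_fun fset_vec.
Proof.
move=> c; apply/colP => j.
by rewrite mxE /vec_fun valK enum_valK.
Qed.

Lemma sum_fset_enum (F : I -> R) :
  \sum_(q <- S) F q = \sum_(j < #|{: S}|) F (val (enum_val j)).
Proof. by rewrite big_seq_fsetE/= big_enum_val. Qed.

End FsetVectors.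

(** * Probabilities and expectations for lattice-valued variables *)

Section Chain.
Context {R : realType} {disp : measure_display} {T : measurableType disp}.
Variable P : probability T R.

Lemma prob_ge0 (A : set T) : 0 <= prob P A.
Proof. exact: fine_ge0. Qed.

Lemma le_prob (A B : set T) : measurable A -> measurable B -> A `<=` B ->
  prob P A <= prob P B.
Proof.
move=> mA mB AB; apply: fine_le; rewrite ?fin_num_measure//.
by apply: le_measure; rewrite ?inE.
Qed.

Lemma probE (A : set T) : measurable A -> (prob P A)%:E = P A.
Proof. by move=> mA; rewrite fineK// fin_num_measure. Qed.

Lemma subset_prob0 (A B : set T) : measurable A -> measurable B ->
  P B = 0%E -> A `<=` B -> prob P A = 0.
Proof. by move=> mA mB PB AB; rewrite /prob (subset_measure0 mA mB AB PB). Qed.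

Lemma prob_setIl (A B : set T) : measurable A -> measurable B ->
  prob P A = 1 -> prob P (A `&` B) = prob P B.
Proof.
move=> mA mB A1.
have PAC : P (~` A) = 0%E by rewrite probability_setC// -probE// A1 subee.
have BA0 : P (B `\` A) = 0%E.
  apply: (subset_measure0 _ _ _ PAC); first exact: measurableD.
    exact: measurableC.
  by move=> w [].
have PB : P B = (P (B `\` A) + P (B `&` A))%E by exact: measureDI.
by rewrite /prob PB BA0 add0e setIC.
Qed.

Section Discrete.
Context {d : nat}.
Implicit Types (g : Zd d -> R) (X : T -> Zd d).

Lemma measurable_discrete g X : (forall A, measurable (X @^-1` A)) ->
  measurable_fun setT (EFin \o (g \o X)).
Proof.
move=> mX; apply/measurable_EFinP => _ B mB; rewrite setTI.
exact: (mX (g @^-1` B)).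
Qed.

(** Almost surely, [g \o X] coincides with the finite combination of indicator
functions [\sum_(i <- S) g (phi i) * \1_(X = phi i)], which is integrated term by
term. *)
Lemma expectation_finite_support {I : choiceType} (S : {fset I})
    (phi : I -> Zd d) g X :
  (forall A, measurable (X @^-1` A)) ->
  {in S &, injective phi} ->
  P [set w | g (X w) != 0 /\ X w \notin map phi S] = 0%E ->
  'E_P[fun w => g (X w)]%E =
    (\sum_(i <- S) prob P [set w | X w = phi i] * g (phi i))%:E.
Proof.
move=> mX phiI null.
pose G (v : Zd d) := \sum_(i <- S) g (phi i) * (v == phi i)%:R.
have mfib v : measurable [set w | X w = v] by exact: (mX [set v]).
(* [unlock] exposes the integral behind the sealed expectation. *)
rewrite unlock (ae_eq_integral (fun w => (G (X w))%:E)) => //; last 3 first.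
- exact: (measurable_discrete g mX).
- exact: (measurable_discrete G mX).
- exists [set w | g (X w) != 0 /\ X w \notin map phi S]; split => //.
    exact: (mX [set v | g v != 0 /\ v \notin map phi S]).
  move=> w /= nfG; apply: contrapT => ngw; apply: nfG => _; congr EFin.
  rewrite /G.
  have [/mapP[i iS ->]|XwS] := boolP (X w \in map phi S).
    rewrite (big_fsetD1 i)//= eqxx mulr1 big_seq big1 ?addr0// => j.
    rewrite !inE => /andP[ji jS]; rewrite [_ == _](_ : _ = false) ?mulr0//.
    by apply/negbTE; apply: contra ji => /eqP/phiI => /(_ iS jS) ->.
  have gX0 : g (X w) = 0.
    by apply/eqP; apply: contra_notT ngw => gX0; split.
  rewrite gX0 big_seq big1// => j jS.
  have /negbTE -> : X w != phi j by apply: contra XwS => /eqP ->; exact: map_f.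
  by rewrite mulr0.
have GE w : (G (X w))%:E =
    (\sum_(i <- S) (g (phi i))%:E * (\1_[set w | X w = phi i] w)%:E)%E.
  rewrite /G -sumEFin; apply: eq_bigr => i _.
  rewrite EFinM indicE; congr (_ * (_%:R)%:E)%E.
  have [XE|XE] := eqVneq; first by rewrite mem_set.
  by rewrite memNset//=; exact/eqP.
under eq_integral do rewrite GE.
rewrite integral_sum//; last first.
  by move=> i; apply: integrableZl => //; exact: integrable_indic.
rewrite -sumEFin; apply: eq_bigr => i _.
rewrite integralZl//; last exact: integrable_indic.
rewrite integral_indic// setIT mulrC EFinM.
by congr mule; apply/esym/probE.
Qed.

End Discrete.

(** * Finite-dimensional laws of the walk *)

Section Walk.
Context {d : nat} (p : Zd d -> Zd d -> R) (Z : Zd d -> nat -> T -> Zd d).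
Hypothesis Z_markov : forall x, markov_chain P p x (Z x).
Hypothesis Z_step : forall x,
  \sum_(i < d.+1) prob P [set w | Z x 1%N w = x + unitv i] +
  \sum_(i < d.+1) prob P [set w | Z x 1%N w = x - unitv i] = 1.
Hypothesis Z_pos : forall x (i : 'I_d.+1),
  0 < prob P [set w | Z x 1%N w = x + unitv i] /\
  0 < prob P [set w | Z x 1%N w = x - unitv i].

Implicit Types (x y z v k : Zd d) (s t u n : nat) (g h : Zd d -> R).

Lemma measurable_chain x n (A : set (Zd d)) : measurable (Z x n @^-1` A).
Proof. by case: (Z_markov x). Qed.
#[local] Hint Resolve measurable_chain : core.

Lemma measurable_at x n v : measurable [set w | Z x n w = v].
Proof. exact: (measurable_chain x n [set v]). Qed.
#[local] Hint Resolve measurable_at : core.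

Lemma measurable_past x n (a : nat -> Zd d) : measurable (past (Z x) n a).
Proof.
have -> : past (Z x) n a =
    \bigcap_i (Z x i @^-1` [set v | (i <= n)%N -> v = a i]).
  by apply/seteqP; split => w /= H i; [move=> _; exact: H|exact: (H i I)].
exact: bigcapT_measurable.
Qed.
#[local] Hint Resolve measurable_past : core.

Lemma past0 x (a : nat -> Zd d) : past (Z x) 0 a = [set w | Z x 0 w = a 0%N].
Proof.
apply/seteqP; split => w /=; first by move/(_ 0%N)->.
by move=> Zx [|].
Qed.

Lemma kernelE x v : p x v = law P Z x 1 v.
Proof.
pose a i := if i is 0%N then x else v.
have [_ Z0 /(_ 0%N a)] := Z_markov x.
rewrite past0 Z0 divr1 => /(_ (oner_neq0 _)) <-.
exact: prob_setIl.
Qed.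

(** The events that the first step is one of the [2 (d + 1)] unit steps are disjoint
and their probabilities add up to one, so their union is almost sure. *)
Lemma law1_neq0_unitv x v : law P Z x 1 v != 0 ->
  exists i, v = x + unitv i \/ v = x - unitv i.
Proof.
apply: contra_neqP => /forallNP vN.
pose phi (q : 'I_d.+1 * bool) := x + (if q.2 then - unitv q.1 else unitv q.1).
have phi_inj : injective phi.
  move=> [i b] [j c] /addrI/rowP/(_ i).
  by case: b; case: c => /=; rewrite !mxE !eqxx/=; case: eqVneq => // ->.
pose F q := [set w | Z x 1 w = phi q].
have tF : trivIset setT F.
  apply/trivIsetP => q q' _ _ /eqP qq'; apply/seteqP; split => // w [/= Zq Zq'].
  by apply: qq'; apply: phi_inj; rewrite -Zq -Zq'.
have PU : P (\bigcup_(q in setT) F q) = 1%E.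
  rewrite (measure_fin_bigcup P finite_finset tF); last first.
    by move=> q _; exact: measurable_at.
  rewrite (fsbigE (index_enum _)) ?index_enum_uniq//; last first.
    by move=> q _; rewrite mem_index_enum.
  under eq_bigl do rewrite in_setT.
  rewrite (eq_bigr (fun q => (prob P (F (q.1, q.2)))%:E)); last first.
    by move=> [i b] _; apply/esym/probE; exact: measurable_at.
  rewrite sumEFin; congr EFin; rewrite -(Z_step x) -big_split/=.
  rewrite -(pair_bigA _ (fun i b => prob P (F (i, b))))/=.
  by apply: eq_bigr => i _; rewrite big_bool addrC.
have mU : measurable (\bigcup_(q in setT) F q).
  by apply: fin_bigcup_measurable => // q _; exact: measurable_at.
have UC0 : P (~` \bigcup_(q in setT) F q) = 0%E.
  by rewrite (probability_setC P mU) PU subee.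
apply: (subset_prob0 (measurable_at x 1 v) (measurableC mU) UC0).
move=> w /= Zv [[i b] _ /= Zq]; apply: (vN i); rewrite -Zv Zq /phi/=.
by case: b {Zq}; [right|left].
Qed.

(** One step of the product formula for path probabilities. When the past is null,
the Markov property says nothing, but then both sides vanish. *)
Lemma prob_pastS x n (a : nat -> Zd d) : prob P (past (Z x) n.+1 a) =
  prob P (past (Z x) n a) * law P Z (a n) 1 (a n.+1).
Proof.
have pastS : past (Z x) n.+1 a =
    past (Z x) n a `&` [set w | Z x n.+1 w = a n.+1].
  apply/seteqP; split => w /= => [H|[H Hn] i].
    by split => [i ni|]; apply: H => //; exact: leqW.
  by rewrite leq_eqVlt ltnS => /orP[/eqP ->//|]; exact: H.
have [past_eq0|past_neq0] := eqVneq (prob P (past (Z x) n a)) 0.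
  rewrite past_eq0 mul0r pastS; apply/eqP; rewrite eq_le prob_ge0 andbT -past_eq0.
  by apply: le_prob; [exact: measurableI|exact: measurable_past|exact: subIsetl].
have [_ _ /(_ _ _ past_neq0)] := Z_markov x.
by rewrite -pastS kernelE => <-; rewrite mulrC divfK.
Qed.

Lemma past_neq0_reach x n (a : nat -> Zd d) :
  prob P (past (Z x) n a) != 0 -> reach x n (a n).
Proof.
elim: n => [|n IH].
  apply: contra_neqT => ax; rewrite past0.
  have -> : [set w | Z x 0 w = a 0%N] =
      ~` [set w | Z x 0 w = x] `&` [set w | Z x 0 w = a 0%N].
    apply/seteqP; split => w /= [] // ->; split => //.
    by move=> a0; move: ax; rewrite a0 reach_refl.
  have [_ Z0 _] := Z_markov x.
  have ZC0 : P (~` [set w | Z x 0 w = x]) = 0%E.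
    by rewrite probability_setC// -[X in (_ - X)%E]probE// Z0 subee.
  apply: (subset_prob0 _ _ ZC0); last exact: subIsetl.
    by apply: measurableI; [apply: measurableC|]; exact: measurable_at.
  by apply: measurableC; exact: measurable_at.
rewrite prob_pastS mulf_eq0 negb_or => /andP[/IH xan /law1_neq0_unitv[i ani]].
by rewrite -[X in reach _ X _]addn1; apply: reach_trans xan _;
  exact: reach_unitv ani.
Qed.

(** The event that the walk leaves the reachable set is covered by the events that
it follows a given path of [n] steps with unreachable endpoint. Finite paths are
countably many, and these events are null by [past_neq0_reach]. *)
Lemma chain_reach_ae x n : P [set w | ~~ reach x n (Z x n w)] = 0%E.
Proof.
have mB : measurable [set w | ~~ reach x n (Z x n w)].
  exact: (measurable_chain x n [set v | ~~ reach x n v]).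
apply/(negligibleP _ mB).
(* [F] runs over all finite sequences of lattice points, coded by integers. *)
pose F m := if (choice.unpickle m : option (seq (Zd d))) is Some l then
   past (Z x) n (nth 0 l) `&` [set w | ~~ reach x n (nth 0 l n)] else set0.
apply: (@negligibleS _ _ _ _ (\bigcup_m F m)).
  move=> w /= xn; pose l := [seq Z x i w | i <- iota 0 n.+1].
  have lE i : (i <= n)%N -> nth 0 l i = Z x i w.
    by move=> ni; rewrite (nth_map 0%N) ?size_iota// nth_iota.
  exists (choice.pickle l) => //; rewrite /F choice.pickleK; split => [i ni|/=].
    by rewrite lE.
  by rewrite lE.
apply: negligible_bigcup => m; rewrite /F.
case: choice.unpickle => [l|]; last exact: negligible_set0.
have [nR|nR] := boolP (reach x n (nth 0 l n)).
  by apply: (negligibleS _ (negligible_set0 _)) => w [_ /negP].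
apply: (@negligibleS _ _ _ _ (past (Z x) n (nth 0 l))); first exact: subIsetl.
apply/(negligibleP _ (measurable_past x n _)); rewrite -[LHS]probE; last first.
  exact: measurable_past.
by congr EFin; apply: contraNeq nR; exact: past_neq0_reach.
Qed.

Lemma law_neq0_reach x n v : law P Z x n v != 0 -> reach x n v.
Proof.
apply: contra_neqT => xv.
apply: (subset_prob0 (measurable_at x n v) _ (chain_reach_ae x n)).
  exact: (measurable_chain x n [set v | ~~ reach x n v]).
by move=> w /= ->.
Qed.

(** The end point at distance [n] below the start has only the straight path leading
to it, but a lower bound by the probability of that path suffices. *)
Lemma law_down_gt0 x n : 0 < law P Z x n (x - e_last d *+ n).
Proof.
pose a i := x - e_last d *+ i.
apply: (@lt_le_trans _ _ (prob P (past (Z x) n a))); last first.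
  by apply: le_prob => // w /=; exact.
elim: n => [|n IH].
  have [_ Z0 _] := Z_markov x.
  by rewrite past0 /a mulr0n subr0 Z0.
rewrite prob_pastS mulr_gt0//; have [_] := Z_pos (a n) ord_max.
by rewrite /law /a mulrSr opprD addrA.
Qed.

(** * The linear systems and their consistency *)

Local Notation S := (@S_fset d).
Local Notation e := (@e_last d).

(** The reason is that row [(s, y)] of [W^+] or [W^-] is supported by the columns in
[S s y], these being the only reachable end points. The blocks of both matrices
for [(t, x)] on [S s y] are thus the matrices for [(s, y)]. *)
Lemma vertical_sum_restrict k t x s y (g : nat * Zd d -> R) :
  (k = e \/ k = - e) -> (s, y) \in S t x ->
  \sum_(q <- S t x) law P Z y s (q.2 + k *+ q.1) * g q =
  \sum_(q <- S s y) law P Z y s (q.2 + k *+ q.1) * g q.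
Proof.
move=> kE sy; have [_ y0 _] := S_fsetP _ _ _ _ sy.
apply/esym/big_fset_incl; first exact: S_fset_sub.
move=> [u z] /S_fsetP[/andP[u0 _] z0 _] uzN.
rewrite [law _ _ _ _ _](_ : _ = 0) ?mul0r//.
apply: contraNeq uzN => /law_neq0_reach.
by rewrite reach_vertical_S.
Qed.

(** [W^-] is triangular for the order given by the time component: restricted to
[S s y], row [(s, y)] has only columns [(u, z)] with [u <= s], and [u = s] forces
[z = y]. Its diagonal is positive by [law_down_gt0]. *)
Lemma Wminus_kernel t x (g : nat * Zd d -> R) :
  (forall s y, (s, y) \in S t x ->
     \sum_(q <- S t x) law P Z y s (q.2 + (- e) *+ q.1) * g q = 0) ->
  forall q, q \in S t x -> g q = 0.
Proof.
move=> g0 [s y]; elim/ltn_ind: s y => s IH y sy.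
have := g0 _ _ sy; rewrite vertical_sum_restrict//; last by right.
have [/andP[s0 st] y0 xy] := S_fsetP _ _ _ _ sy.
rewrite (big_fsetD1 (s, y))/=; last exact: S_fset_self.
rewrite big_seq big1 ?addr0 => [/eqP|[u z]].
  rewrite mulNrn mulf_eq0 => /orP[/eqP dg|/eqP//].
  by have := law_down_gt0 y s; rewrite dg ltxx.
rewrite !inE => /andP[uz_neq uz].
have [/andP[u0 us] z0 yz] := S_fsetP _ _ _ _ uz.
rewrite IH ?mulr0//; last exact: (fsubsetP (S_fset_sub sy)).
rewrite ltn_neqAle us andbT; apply: contra uz_neq => /eqP usE.
by move: yz; rewrite usE subnn => /reach0 ->.
Qed.

Lemma Wminus_fset_vec t x (g : nat * Zd d -> R) i :
  (Wminus P Z t x *m fset_vec g) i 0 =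
  let: (s, y) := val (enum_val i) in
  \sum_(q <- S t x) law P Z y s (q.2 + (- e) *+ q.1) * g q.
Proof.
rewrite mxE; case iE: (val (enum_val i)) => [s y].
rewrite sum_fset_enum; apply: eq_bigr => j _; rewrite !mxE iE.
by case: (val (enum_val j)) => u z; rewrite mulNrn.
Qed.

Lemma Wplus_fset_vec t x (g : nat * Zd d -> R) i :
  (Wplus P Z t x *m fset_vec g) i 0 =
  let: (s, y) := val (enum_val i) in
  \sum_(q <- S t x) law P Z y s (q.2 + e *+ q.1) * g q.
Proof.
rewrite mxE; case iE: (val (enum_val i)) => [s y].
rewrite sum_fset_enum; apply: eq_bigr => j _; rewrite !mxE iE.
by case: (val (enum_val j)) => u z.
Qed.

(** [Wminus_kernel] concerns column vectors, whereas invertibility is deduced from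
injectivity on row vectors; hence the passage to the transpose. *)
Lemma Wminus_unit t x : Wminus P Z t x \in unitmx.
Proof.
rewrite -unitmx_tr -row_free_unit; apply: inj_row_free => v.
move/(congr1 trmx); rewrite trmx_mul trmxK trmx0 -(vec_funK v^T) => Wv.
apply: trmx_inj; rewrite trmx0 -(vec_funK v^T).
apply/colP => j; rewrite !mxE; apply: (@Wminus_kernel t x); last exact: valP.
move=> s y sy; have /colP/(_ (enum_rank [` sy]%fset)) := Wv.
by rewrite Wminus_fset_vec enum_rankK /= mxE.
Qed.

Lemma CN_comp_system t x h s y : (s, y) \in S t x ->
  \sum_(q <- S t x) law P Z y s (q.2 + (- e) *+ q.1) * CN_comp P Z t x h q =
  \sum_(q <- S t x) law P Z y s (q.2 + e *+ q.1) * h (q.2 + e *+ q.1).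
Proof.
move=> sy; set c := CN_mx P Z t x *m upper_vec t x h.
have up : upper_vec t x h = fset_vec (fun q => h (q.2 + e *+ q.1)).
  by apply/colP => j; rewrite !mxE; case: (val (enum_val j)).
have Wc : Wminus P Z t x *m c = Wplus P Z t x *m upper_vec t x h.
  by rewrite /c /CN_mx -mulmxA mulKVmx// Wminus_unit.
have := congr1 (fun M : 'cV_ _ => M (enum_rank [` sy]%fset) 0) Wc.
rewrite -[c in LHS]vec_funK up Wminus_fset_vec Wplus_fset_vec enum_rankK/=.
by [].
Qed.

Lemma CN_comp_local_system t x h s y : (s, y) \in S t x ->
  \sum_(q <- S s y) law P Z y s (q.2 + (- e) *+ q.1) * CN_comp P Z t x h q =
  \sum_(q <- S s y) law P Z y s (q.2 + e *+ q.1) * h (q.2 + e *+ q.1).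
Proof.
move=> sy.
have [Nk Pk] : (- e = e \/ - e = - e) /\ (e = e \/ e = - e).
  by split; [right|left].
rewrite -(vertical_sum_restrict _ Nk sy) CN_comp_system//.
exact: (vertical_sum_restrict (fun q => h (q.2 + e *+ q.1)) Pk sy).
Qed.

(** Both sides solve the system of [CN_comp_local_system] on [S s y], whose
solution is unique by [Wminus_kernel]. *)
Lemma CN_comp_restrict t x h s y q : (s, y) \in S t x -> q \in S s y ->
  CN_comp P Z t x h q = CN_comp P Z s y h q.
Proof.
move=> sy qS; apply/eqP; rewrite -subr_eq0; apply/eqP.
apply: (Wminus_kernel (t := s) (x := y)
  (g := fun q => CN_comp P Z t x h q - CN_comp P Z s y h q)) qS => u z uz.
have uztx : (u, z) \in S t x by exact: (fsubsetP (S_fset_sub sy)).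
under eq_bigr do rewrite mulrBr.
have Nk : - e = e \/ - e = - e by right.
by rewrite sumrB !(vertical_sum_restrict _ Nk uz) !CN_comp_local_system// subrr.
Qed.

(** * Expectations over the two half-spaces *)

(** The condition on [g] says that it lives on the open half-space towards which [k]
points; there, [S s y] enumerates the reachable points as [z + k *+ u]. *)
Lemma expectation_half_space k y s g : (k = e \/ k = - e) -> bdry y ->
  (forall v, g v != 0 -> 0 < v 0 ord_max * k 0 ord_max) ->
  'E_P[fun w => g (Z y s w)]%E =
  (\sum_(q <- S s y) law P Z y s (q.2 + k *+ q.1) * g (q.2 + k *+ q.1))%:E.
Proof.
move=> kE y0 gk.
apply: expectation_finite_support => //.
- move=> [u z] [u' z'] /S_fsetP[/andP[u0 _] z0 _].
  move=> /S_fsetP[/andP[u0' _] z0' _]/= E.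
  have uu' : u = u'.
    move/rowP/(_ ord_max): E; rewrite !mxE [z 0 _]z0 [z' 0 _]z0' !mulmxnE.
    by case: kE => ->; rewrite !mxE !eqxx/=; lia.
  by move: E; rewrite uu' => /addIr ->.
- apply: (subset_measure0 _ _ _ (chain_reach_ae y s)).
  + exact: (measurable_chain y s [set v | g v != 0 /\ v \notin _]).
  + exact: (measurable_chain y s [set v | ~~ reach y s v]).
  + move=> w /= [/gk]; move: (Z y s w) => v vk; apply: contra => yv.
    pose u := `|v 0%R ord_max|%N.
    have z0 : bdry (v - k *+ u).
      rewrite /bdry/= !mxE mulmxnE /u.
      by move: vk; case: kE => ->; rewrite !mxE !eqxx/=; lia.
    apply/mapP; exists (u, v - k *+ u) => /=; last by rewrite subrK.
    have u0 : (0 < u)%N.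
      by rewrite /u absz_gt0; apply: contraTneq vk => ->; rewrite mul0r ltxx.
    by rewrite -(reach_vertical_S s kE u0 y0 z0) subrK.
Qed.

Lemma expectation_CN t x h : (0 < t)%N -> bdry x ->
  vanishes_outside (@upper d) h ->
  'E_P[fun w => h (Z x t w)]%E = 'E_P[fun w => CN P Z h (Z x t w)]%E.
Proof.
move=> t0 x0 h_upper.
rewrite (expectation_half_space (k := e)) //; last 2 first.
- by left.
- move=> v; apply: contra_neqP; rewrite !mxE !eqxx mulr1 => vk.
  exact: h_upper.
rewrite (expectation_half_space (k := - e)) //; last 2 first.
- by right.
- move=> v; rewrite !mxE !eqxx mulrN mulr1 oppr_gt0; rewrite /CN.
  by case: ifP => //; rewrite eqxx.
congr EFin; rewrite -CN_comp_system; last exact: S_fset_self.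
apply: eq_big_seq => -[u z] uz; congr (_ * _) => /=.
have [/andP[u0 _] z0 _] := S_fsetP _ _ _ _ uz.
rewrite mulNrn CN_sub//; apply: CN_comp_restrict uz _.
exact: S_fset_self.
Qed.

End Walk.
End Chain.

Theorem theorem7 (R : realType) (disp : measure_display)
    (T : measurableType disp) (P : probability T R) (d : nat)
    (p : Zd d -> Zd d -> R) (Z : Zd d -> nat -> T -> Zd d)
    (Z_markov : forall x, markov_chain P p x (Z x))
    (Z_step : forall x,
       \sum_(i < d.+1) prob P [set w | Z x 1%N w = x + unitv i] +
       \sum_(i < d.+1) prob P [set w | Z x 1%N w = x - unitv i] = 1)
    (Z_pos : forall x (i : 'I_d.+1),
       0 < prob P [set w | Z x 1%N w = x + unitv i] /\
       0 < prob P [set w | Z x 1%N w = x - unitv i])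
    (t : nat) (x : Zd d) (t_gt0 : (0 < t)%N) (x_bdry : bdry x)
    (f : Zd d -> R) (f_upper : vanishes_outside (@upper d) f) :
  ('E_P[(fun w => f (Z x t w))] = 'E_P[(fun w => CN P Z f (Z x t w))])%E.
Proof.
exact: expectation_CN.
Qed.
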